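(* Let $E$ be a Banach space and let $X,Y\subset E$ be closed subspaces such that $X\cong Y$ and $X\oplus Y=E$. Let $m$ be a positive integer and suppose that $X$ is isomorphic to its closed subspaces of codimension $m$. Let $P$ be the projector onto $X$ with kernel $Y$. Then $P$ is path-connected in $\mathcal{P}(\mathcal{L}(E))$ to a projector $Q$ such that $Q-P$ is compact and $[Q-P]=m$.
   Context: $\mathcal{L}(E)$ is the Banach algebra of bounded operators on $E$ and $\mathcal{P}(\mathcal{L}(E))=\{Q\in\mathcal{L}(E):Q^2=Q\}$ is the set of projectors with the operator norm topology. Isomorphic ($\cong$) means linearly homeomorphic. For projectors $Q,R$ with $Q-R$ compact, $[Q-R]$ denotes the Fredholm index of $R|_{\mathrm{Range}(Q)}\colon\mathrm{Range}(Q)\to\mathrm{Range}(R)$. *)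

(* Defs.v *)
From HB Require Import structures.
From mathcomp Require Import all_boot all_order all_algebra.
From mathcomp Require Import complex.
From mathcomp Require Import all_classical all_reals all_analysis.

Set Implicit Arguments.
Unset Strict Implicit.
Unset Printing Implicit Defensive.

Import Order.TTheory GRing.Theory Num.Theory.
Import numFieldNormedType.Exports.

Local Open Scope classical_set_scope.
Local Open Scope ring_scope.

(* A Banach space is a [completeNormedModType K] whose scalar field [K] is
   either the field [R] of real numbers or the field [R[i]] of complex
   numbers.  The other definitions make sense over any [numFieldType]. *)
Variant real_or_complex (R : realType) : numFieldType -> Prop :=
| RealScalars : real_or_complex R R
| ComplexScalars : real_or_complex R R[i].

Record bounded_operator (K : numFieldType) (E : normedModType K) :=
  BoundedOperator {
    bop_fun :> {linear E -> E};
    bop_continuous : continuous bop_fun }.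

Section OperatorNormTopology.
Context {K : numFieldType} {E : normedModType K}.
Implicit Types (S T U : bounded_operator E) (e : K).

(* The operator norm of S - T is the infimum of the constants c such that
   |S x - T x| <= c |x| for all x, so this is the open ball of centre T and
   radius e for the operator norm. *)
Definition opnorm_ball T e : set (bounded_operator E) :=
  [set S | exists2 c : K, c < e & forall x : E, `|S x - T x| <= c * `|x|].

Lemma opnorm_ball_center T e : 0 < e -> opnorm_ball T e T.
Proof. by move=> e0; exists 0 => // x; rewrite subrr normr0 mul0r. Qed.

Lemma opnorm_ball_sym T S e : opnorm_ball T e S -> opnorm_ball S e T.
Proof. by case=> c ce H; exists c => // x; rewrite distrC. Qed.

Lemma opnorm_ball_triangle T S U e1 e2 :
  opnorm_ball T e1 S -> opnorm_ball S e2 U -> opnorm_ball T (e1 + e2) U.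
Proof.
case=> c1 c1e H1 [c2 c2e H2]; exists (c2 + c1); first by rewrite addrC ltrD.
move=> x; rewrite mulrDl -(subrKA (S x)) (le_trans (ler_normD _ _))//.
exact: lerD.
Qed.

HB.instance Definition _ := gen_eqMixin (bounded_operator E).
HB.instance Definition _ := gen_choiceMixin (bounded_operator E).
HB.instance Definition _ := hasNbhs.Build (bounded_operator E)
  (nbhs_ (entourage_ opnorm_ball)).
HB.instance Definition _ := Nbhs_isPseudoMetric.Build K (bounded_operator E)
  erefl opnorm_ball_center opnorm_ball_sym opnorm_ball_triangle erefl.

End OperatorNormTopology.

Section Projectors.
Context {K : numFieldType} {E : normedModType K}.

Definition projectors : set (bounded_operator E) :=
  [set Q | forall x, Q (Q x) = Q x].

Definition path_connected_in (R : realType) (A : set (bounded_operator E))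
    (P Q : bounded_operator E) : Prop :=
  exists gamma : R -> bounded_operator E,
    [/\ {within `[0, 1]%classic, continuous gamma},
        forall t : R, `[0, 1]%classic t -> A (gamma t),
        gamma 0 = P & gamma 1 = Q].

Definition compact_operator (T : E -> E) : Prop :=
  precompact (T @` [set x | `|x| <= 1]).

Definition closed_subspace (X : set E) : Prop :=
  GRing.submod_closed [in X] /\ closed X.

Definition linearly_homeomorphic (X Y : set E) : Prop :=
  exists f g : E -> E,
    [/\ set_fun X Y f, set_fun Y X g,
        {in X, cancel f g} & {in Y, cancel g f}] /\
    [/\ {in X &, forall x y, f (x + y) = f x + f y},
        forall a, {in X, forall x, f (a *: x) = a *: f x},
        {within X, continuous f} & {within Y, continuous g}].

Definition direct_sum_decomposition (X Y : set E) : Prop :=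
  X `&` Y = [set 0] /\
  forall e, exists x y, [/\ X x, Y y & e = x + y].

(* [codim V W n] : the quotient space V / W has dimension n, i.e. the classes
   modulo W of some v_0, ..., v_(n-1) in V form a basis of V / W. *)
Definition codim (V W : set E) (n : nat) : Prop :=
  W `<=` V /\
  exists2 v : 'I_n -> E, (forall i, V (v i)) &
    forall x, V x -> exists! a : 'rV[K]_n, W (x - \sum_(i < n) a 0 i *: v i).

Definition has_dim (V : set E) (n : nat) : Prop := codim V [set 0] n.

(* [fredholm_index T V W k] : the restriction T : V -> W is a Fredholm operator
   of index k. *)
Definition fredholm_index (T : E -> E) (V W : set E) (k : int) : Prop :=
  [/\ set_fun V W T, closed (T @` V) &
    exists a b : nat, [/\ has_dim (V `&` T @^-1` [set 0]) a,
                          codim W (T @` V) b & k = a%:Z - b%:Z]].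

(* The index [Q - R] of a pair of projectors: the Fredholm index of
   R : Range(Q) -> Range(R). *)
Definition projector_index (Q R : bounded_operator E) (k : int) : Prop :=
  fredholm_index R (range Q) (range R) k.

End Projectors.

(* Main.v *)
Require Import Defs.
From HB Require Import structures.
From mathcomp Require Import all_boot all_order all_algebra.
From mathcomp Require Import complex.
From mathcomp Require Import all_classical all_reals all_analysis.
From mathcomp Require Import lra.

Import Order.TTheory GRing.Theory Num.Theory.
Import numFieldNormedType.Exports.

Set Implicit Arguments.
Unset Strict Implicit.
Unset Printing Implicit Defensive.

Local Open Scope classical_set_scope.
Local Open Scope ring_scope.

(** Identify E with X x X through an isomorphism f : X -> Y, so that P becomes
(x, y) |-> (x, 0).  Choose a closed subspace X' of codimension m in X, let
N : X -> X be a bounded projector onto X', and let h : X -> X' be an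
isomorphism.  The target is Q (x, y) = (x, y - N y): its range is X enlarged by
the m-dimensional space F = f (ker N), and its kernel is Y' = f X'.  Then Q - P
has finite rank, and P restricted to the range of Q is onto X with kernel F, so
the index is m.

The substance is the path.  Two projectors with the same range, or with the
same kernel, are joined by a straight segment of projectors, because then
S T + T S = S + T.  So it suffices to find a chain of decompositions of E in
which consecutive ones share the range or the kernel.  Writing
(range | kernel), a chain that works is

- (X | Y), the projector P;
- (A | Y), where A is the diagonal, the set of all (x, x);
- (A | Z), where Z is the set of all (h z - z, h z);
- (X + F | Z);
- (X + F | Y'), the projector Q.

The subspace Z is a common complement of A and of X + F.  It is a complement of
A because subtracting the two coordinates of (h z - z, h z) gives back z, which
ranges over all of X; it is a complement of X + F because the second coordinate
h z ranges bijectively over X'.  This is the only place where the isomorphism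
between X and X' enters, and it is what lets the chain change the index.

The remaining work is the boundedness of N.  The coordinates in a basis of X
modulo X' are bounded because the unit sphere of K^m is compact, so its image
under a |-> \sum_i a_i v_i, which avoids the closed subspace X', stays at a
positive distance from X' (lemma [span_away]). *)

(** * The scalars *)

Lemma real_complex_continuous (R : realType) :
  continuous (fun x : R => x%:C%C : (R[i] : numFieldType)).
Proof.
move=> x; apply/cvgrPdist_lt => e e0.
(* Positive elements of R[i] are real. *)
have [r er] : exists r : R, e = r%:C%C.
  by exists (complex.Re e); rewrite RRe_real// gtr0_real.
have r0 : 0 < r by rewrite -ltcR -er.
near=> y; rewrite -rmorphB er normc_def/= expr0n/= addr0 sqrtr_sqr ltcR.
near: y; exact: cvgr_dist_lt.
Unshelve. all: by end_near. Qed.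

Lemma scalar_embedding (R : realType) (K : numFieldType) :
  real_or_complex R K ->
  exists iota : R -> K, [/\ continuous iota, iota 0 = 0 & iota 1 = 1].
Proof.
case; first by exists id; split => // x.
exists (fun x : R => x%:C%C : (R[i] : numFieldType)); split => //.
exact: real_complex_continuous.
Qed.

(** Local compactness of the scalars.  A compact superset of the ball serves as
well as the ball itself; over R[i] it is a square. *)
Lemma scalar_ball_compact (R : realType) (K : numFieldType) (C : K) :
  real_or_complex R K ->
  exists2 B : set K, compact B & forall a : K, `|a| <= C -> B a.
Proof.
move=> hK; case: hK C => C.
  exists `[- C, C]%classic; first exact: segment_compact.
  by move=> a; rewrite ler_norml/= in_itv.
pose c := complex.Re C.
pose f (z : R * R) : (R[i] : numFieldType) := z.1%:C%C + 'i%C * z.2%:C%C.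
exists (f @` (`[- c, c] `*` `[- c, c])); last first.
  move=> a aC; exists (complex.Re a, complex.Im a); last by rewrite /f -complexE.
  have bnd (x : R) : x ^+ 2 <= complex.Re a ^+ 2 + complex.Im a ^+ 2 ->
      `[- c, c]%classic x.
    move=> xa; rewrite /= in_itv/= -ler_norml.
    have := aC; rewrite normc_def => /(le_trans _) aC'.
    have := aC' (`|x|%:C)%C; rewrite lecR -sqrtr_sqr => /(_ (ler_wsqrtr xa)).
    by rewrite lecE/= => /andP[].
  by split; apply: bnd; rewrite /= ?lerDl ?lerDr sqr_ge0.
apply: continuous_compact; last first.
  by apply: compact_setX; exact: segment_compact.
apply: continuous_subspaceT => z; apply: cvgD.
  apply: (@cvg_comp _ _ _ fst (fun x : R => x%:C%C : (R[i] : numFieldType)));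
    first exact: cvg_fst.
  exact: real_complex_continuous.
apply: cvgM; first exact: cvg_cst.
apply: (@cvg_comp _ _ _ snd (fun x : R => x%:C%C : (R[i] : numFieldType)));
    first exact: cvg_snd.
exact: real_complex_continuous.
Qed.

(** * Bounded operators and segments of projectors *)

Section BoundedOperators.
Context {K : numFieldType} {E : normedModType K}.
Implicit Types (A B C T : bounded_operator E).

Lemma bopD T x y : T (x + y) = T x + T y. Proof. exact: linearD. Qed.
Lemma bopB T x y : T (x - y) = T x - T y. Proof. exact: linearB. Qed.
Lemma bopZ T k x : T (k *: x) = k *: T x. Proof. exact: linearZ. Qed.
Lemma bop0 T : T 0 = 0. Proof. exact: linear0. Qed.

Definition bop_of (f : E -> E) (lin_f : linear f) (cont_f : continuous f) :
    bounded_operator E :=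
  @BoundedOperator K E
    (HB.pack f (GRing.isLinear.Build K E E *:%R f lin_f)) cont_f.

Lemma bop_ext A B : A =1 B -> A = B.
Proof.
case: A B => [[f cf] contf] [[g cg] contg] /= /funext fg.
subst g.
have cfg : cf = cg.
  case: cf cg {contf contg} => [[Df] [Zf]] [[Dg] [Zg]].
  by rewrite (Prop_irrelevance Df Dg) (Prop_irrelevance Zf Zg).
by subst cg; rewrite (Prop_irrelevance contf contg).
Qed.

Lemma bop_bound T : exists2 M : K, 0 < M & forall x, `|T x| <= M * `|x|.
Proof.
have /linear_boundedP : bounded_near T (nbhs 0).
  exact/linear_bounded_continuous/bop_continuous.
move=> bnd; near (pinfty_nbhs K) => M; exists M => //.
by near: M; exact: bnd.
Unshelve. all: by end_near. Qed.

Lemma bop_comp_linear A B : linear (A \o B).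
Proof. by move=> k x y /=; rewrite !linearP. Qed.

Lemma bop_comp_continuous A B : continuous (A \o B).
Proof. by move=> x; apply: continuous_comp; exact: bop_continuous. Qed.

Definition bop_comp A B : bounded_operator E :=
  bop_of (@bop_comp_linear A B) (@bop_comp_continuous A B).

Lemma bop_lincomb_linear A (s : K) B : linear (fun x => A x + s *: B x).
Proof.
move=> k x y; rewrite (linearP A) (linearP B) scalerDr scalerDr !scalerA.
by rewrite (mulrC s) addrACA.
Qed.

Lemma bop_lincomb_continuous A (s : K) B : continuous (fun x => A x + s *: B x).
Proof.
move=> x; apply: cvgD; first exact: bop_continuous.
by apply: cvgZl_tmp; exact: bop_continuous.
Qed.

Definition bop_lincomb A (s : K) B : bounded_operator E :=
  bop_of (@bop_lincomb_linear A s B) (@bop_lincomb_continuous A s B).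

Definition bop_add A B := bop_lincomb A 1 B.
Definition bop_sub A B := bop_lincomb A (-1) B.

Lemma bop_addE A B x : bop_add A B x = A x + B x.
Proof. by rewrite /= scale1r. Qed.

Lemma bop_subE A B x : bop_sub A B x = A x - B x.
Proof. by rewrite /= scaleN1r. Qed.

Lemma bop_compE A B x : bop_comp A B x = A (B x). Proof. by []. Qed.

Definition segment A B (s : K) := bop_lincomb A s (bop_sub B A).

Lemma segmentE A B (s : K) x : segment A B s x = A x + s *: (B x - A x).
Proof. by rewrite /= scaleN1r. Qed.

Lemma segment_opnorm_continuous A B : continuous (segment A B).
Proof.
have [M1 M10 hA] := bop_bound A; have [M2 M20 hB] := bop_bound B.
have M0 : 0 < M1 + M2 by rewrite addr_gt0.
move=> s; apply/(@cvg_ballP K _ _ (nbhs s)) => e e0; near=> u.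
exists (`|u - s| * (M1 + M2)) => [|x].
  rewrite -ltr_pdivlMr// distrC; near: u; apply: cvgr_dist_lt => //.
  by rewrite divr_gt0.
rewrite !segmentE opprD addrACA subrr add0r -scalerBl normrZ -mulrA ler_wpM2l//.
by rewrite (le_trans (ler_normB _ _))// mulrDl addrC lerD.
Unshelve. all: by end_near. Qed.

Lemma segment0 A B : segment A B 0 = A.
Proof. by apply: bop_ext => x; rewrite segmentE scale0r addr0. Qed.

Lemma segment1 A B : segment A B 1 = B.
Proof. by apply: bop_ext => x; rewrite segmentE scale1r subrKC. Qed.

(** Expanding the square of A + s (B - A), the coefficient of s^2 is
A + B - A B - B A. *)
Lemma segment_projectors A B (s : K) :
  projectors A -> projectors B ->
  (forall x, A (B x) + B (A x) = A x + B x) -> projectors (segment A B s).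
Proof.
move=> pA pB AB x; rewrite !segmentE !(bopB, bopD, bopZ) pA pB.
set u := A x; set v := B x; set w := A v; set z := B u.
have wz : w + z = u + v by exact: AB.
have vz : v - z = w - u.
  by apply/eqP; rewrite subr_eq addrAC wz addrAC subrr add0r.
have zu : z - u = v - w.
  by apply/eqP; rewrite subr_eq addrAC eq_sym subr_eq addrC -wz addrC.
rewrite vz opprD addrACA subrr addr0 zu.
by rewrite -addrA -scalerDr addrC [w - u + _]addrC subrKA addrC.
Qed.

Lemma same_range_segment A B (s : K) :
  (forall x, A (B x) = B x) -> (forall x, B (A x) = A x) ->
  projectors (segment A B s).
Proof.
move=> AB BA; apply: segment_projectors => x.
- by rewrite -[in A x]BA AB BA.
- by rewrite -[in B x]AB BA AB.
- by rewrite AB BA addrC.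
Qed.

Lemma same_kernel_segment A B (s : K) :
  (forall x, A (B x) = A x) -> (forall x, B (A x) = B x) ->
  projectors (segment A B s).
Proof.
move=> AB BA; apply: segment_projectors => x.
- by rewrite -[LHS]AB BA AB.
- by rewrite -[LHS]BA AB BA.
- by rewrite AB BA.
Qed.

End BoundedOperators.

(** * Paths *)

Lemma within_continuous_comp (T U V : topologicalType) (A : set T) (B : set U)
    (h : T -> U) (f : U -> V) :
  {within A, continuous h} -> set_fun A B h -> {within B, continuous f} ->
  {within A, continuous (f \o h)}.
Proof.
move=> /subspace_continuousP ch hAB /subspace_continuousP cf.
apply/subspace_continuousP => x Ax; apply: cvg_comp; last exact/cf/hAB.
move=> W /(ch _ Ax) hW; change (nbhs x (fun y => A y -> W (h y))).
have {}hW : nbhs x (fun y => A y -> B (h y) -> W (h y)) by exact: hW.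
by apply: filterS hW => y hW Ay; apply: hW => //; exact: hAB.
Qed.

Section Paths.
Context {R : realType} {K : numFieldType} {E : normedModType K}.
Hypothesis hK : real_or_complex R K.
Implicit Types (A B C : bounded_operator E) (D : set (bounded_operator E)).

Lemma segment_path D A B :
  (forall s, D (segment A B s)) -> path_connected_in R D A B.
Proof.
move=> DAB; have [iota [cont_iota iota0 iota1]] := scalar_embedding hK.
exists (segment A B \o iota); split => /=.
- apply: continuous_subspaceT => t; apply: continuous_comp; first exact: cont_iota.
  exact: segment_opnorm_continuous.
- by move=> t _; exact: DAB.
- by rewrite iota0 segment0.
- by rewrite iota1 segment1.
Qed.

Lemma path_trans D A B C :
  path_connected_in R D A B -> path_connected_in R D B C ->
  path_connected_in R D A C.
Proof.
move=> [f [cf Df f0 f1]] [g [cg Dg g0 g1]].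
(* The two paths run at double speed; they agree at t = 1/2. *)
pose h (t : R) := if t <= 2^-1 then f (2 * t) else g (2 * t - 1).
have half : 2 * 2^-1 = 1 :> R by rewrite divff.
exists h; split.
- have -> : `[0, 1]%classic = `[0, 2^-1]%classic `|` `[2^-1, 1]%classic :> set R.
    rewrite eqEsubset; split => t /=; rewrite !in_itv/=.
      by move=> /andP[t0 t1]; have [?|/ltW ?] := leP t 2^-1; [left|right]; apply/andP.
    by case=> /andP[? ?]; lra.
  apply: withinU_continuous; [exact: itv_closed|exact: itv_closed| |].
  + apply: (@subspace_eq_continuous _ _ _ (fun t : R => f (2 * t))).
      by move=> t; rewrite inE/= in_itv/= /h /from_subspace => /andP[_ ->].
    apply: (within_continuous_comp _ _ cf).
      by apply: continuous_subspaceT => t; exact: cvgMr.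
    move=> t.
    by rewrite /= !in_itv/= => /andP[? ?]; lra.
  + apply: (@subspace_eq_continuous _ _ _ (fun t : R => g (2 * t - 1))).
      move=> t; rewrite inE/= in_itv/= /h /from_subspace => /andP[t2 _].
      have [t2'|//] := leP t 2^-1.
      have -> : t = 2^-1 by apply/le_anti; rewrite t2 t2'.
      by rewrite half subrr f1 g0.
    apply: (within_continuous_comp _ _ cg).
      apply: continuous_subspaceT => t.
      by apply: cvgB; [exact: cvgMr|exact: cvg_cst].
    move=> t.
    by rewrite /= !in_itv/= => /andP[? ?]; lra.
- move=> t; rewrite /= in_itv/= /h => /andP[t0 t1]; case: leP => tle.
    by apply: Df; rewrite /= in_itv/=; lra.
  by apply: Dg; rewrite /= in_itv/=; lra.
- by rewrite /h invr_ge0 ler0n mulr0.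
- by rewrite /h ifF ?mulr1; [rewrite -[2]natr1 addrK|apply/negbTE; lra].
Qed.

End Paths.

(** * Closed subspaces of finite codimension *)

Section FiniteCodimension.
Context {R : realType} {K : numFieldType} {E : normedModType K}.
Hypothesis hK : real_or_complex R K.

Lemma coord_le_mx_norm n (a : 'rV[K]_n) i : `|a 0 i| <= `|a|.
Proof.
rewrite [leRHS]/Num.norm/= mx_normE -[leLHS]nngE num_le.
exact: (le_bigmax _ (fun ij : 'I_1 * 'I_n => `|a ij.1 ij.2|%:nng) (0, i)).
Qed.

Lemma lincomb_continuous n (v : 'I_n -> E) :
  continuous (fun a : 'rV[K]_n => \sum_(i < n) a 0 i *: v i).
Proof.
apply: continuous_big => [|i _]; first exact: add_continuous.
by move=> a; apply: continuousZr_tmp; exact: coord_continuous.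
Qed.

Lemma unit_sphere_compact n : compact [set a : 'rV[K]_n | `|a| = 1].
Proof.
have [B cB hB] := scalar_ball_compact (1 : K) hK.
apply: subclosed_compact (rV_compact (fun=> cB)) _.
  apply: (@closed_comp _ _ (fun a : 'rV[K]_n => `|a|) [set 1]).
    by move=> a _; exact: norm_continuous.
  apply: accessible_closed_set1; apply: hausdorff_accessible.
  exact: norm_hausdorff.
by move=> a /= a1 i; apply: hB; rewrite -a1 coord_le_mx_norm.
Qed.

Lemma subspace_lincomb (W : set E) (k : K) x y :
  closed_subspace W -> W x -> W y -> W (k *: x + y).
Proof. by move=> [[_ linW] _] Wx Wy; have := linW k x y; rewrite !inE; apply. Qed.

Lemma subspace0 (W : set E) : closed_subspace W -> W 0.
Proof. by move=> [[W0 _] _]; rewrite inE in W0. Qed.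

Lemma subspaceB (W : set E) x y : closed_subspace W -> W x -> W y -> W (x - y).
Proof.
by move=> sW Wx Wy; rewrite addrC -scaleN1r; exact: subspace_lincomb.
Qed.

Lemma subspaceZ (W : set E) (k : K) x : closed_subspace W -> W x -> W (k *: x).
Proof.
by move=> sW Wx; rewrite -[_ *: _]addr0; apply: subspace_lincomb => //; exact: subspace0.
Qed.

Lemma subspace_sum (W : set E) n (a : 'rV[K]_n) (v : 'I_n -> E) :
  closed_subspace W -> (forall i, W (v i)) -> W (\sum_(i < n) a 0 i *: v i).
Proof.
move=> sW Wv; elim/big_ind: _ => [|x y Wx Wy|i _]; first exact: subspace0.
  by rewrite -[x]scale1r; exact: subspace_lincomb.
exact: subspaceZ.
Qed.

Lemma lincombD n (v : 'I_n -> E) (k : K) (a b : 'rV[K]_n) :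
  \sum_(i < n) (k *: a + b) 0 i *: v i =
  k *: (\sum_(i < n) a 0 i *: v i) + \sum_(i < n) b 0 i *: v i.
Proof.
rewrite scaler_sumr -big_split; apply: eq_bigr => i _.
by rewrite !mxE scalerDl scalerA.
Qed.

(** The linear combinations of norm-one coefficient vectors form a compact set
disjoint from the closed subspace W, hence at a positive distance d from it;
the general case follows by scaling. *)
Lemma span_away (W : set E) n (v : 'I_n -> E) :
  closed_subspace W ->
  (forall a : 'rV[K]_n, W (\sum_(i < n) a 0 i *: v i) -> a = 0) ->
  exists2 d : K, 0 < d & forall w (a : 'rV[K]_n), W w ->
    d * `|a| <= `|w + \sum_(i < n) a 0 i *: v i|.
Proof.
move=> sW indep.
pose f (a : 'rV[K]_n) := \sum_(i < n) a 0 i *: v i.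
have fZ k a : f (k *: a) = k *: f a.
  by rewrite /f -[k *: a]addr0 lincombD [X in _ + X]big1 ?addr0// => i _;
    rewrite mxE scale0r.
have /(compact_near_coveringP _).1 cov := @unit_sphere_compact n.
pose P (d : K) (a : 'rV[K]_n) := forall w, W w -> d <= `|w + f a|.
(* Locally the distance to W is bounded below by half of the radius r of a
   ball around f a that misses W; compactness makes the bound uniform. *)
have /(cov K (0 : K)^'+ P _) near_d : forall a, `|a| = 1 ->
    \forall b \near a & d \near (0 : K)^'+, P d b.
  move=> a a1; have nWfa : ~ W (f a).
    by move=> /indep a0; move: a1; rewrite a0 normr0 => /eqP; rewrite eq_sym oner_eq0.
  have : nbhs (f a) (~` W).
    by apply: open_nbhs_nbhs; split => //; apply: closed_openC; case: sW.
  move=> /nbhs_normP[r r0 rW].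
  exists ([set b | `|f a - f b| < r / 2], [set d | 0 < d < r / 2]) => /=.
    split.
      by have /cvgrPdist_lt := @lincomb_continuous n v a; apply; rewrite divr_gt0.
    near=> d; apply/andP; split; near: d; first exact: nbhs_right_gt.
    by apply: nbhs_right_lt; rewrite divr_gt0.
  move=> [b d] /= [fab /andP[d0 dr]] w Ww.
  rewrite real_leNgt ?ger0_real// ?ltW//; apply/negP => wd.
  (* Otherwise - w would be a point of W within r of f a. *)
  apply: (rW (- w)); last by rewrite -scaleN1r; exact: subspaceZ.
  rewrite /= opprK -(subrKA (f b)) (le_lt_trans (ler_normD _ _))//.
  by rewrite [r]splitr ltrD// addrC (lt_trans wd).
near (0 : K)^'+ => d.
have d0 : 0 < d by near: d; exact: nbhs_right_gt.
exists d => // w a Ww; rewrite -/(f a).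
have [->|a0] := eqVneq a 0; first by rewrite normr0 mulr0.
have na0 : 0 < `|a| by rewrite normr_gt0.
rewrite -ler_pdivlMr// -[`|a|]normr_id -normfV mulrC -normrZ scalerDr -fZ.
have hd : [set a : 'rV[K]_n | `|a| = 1] `<=` P d by near: d; exact: near_d.
apply: hd; last exact: subspaceZ.
by rewrite /= normrZ normfV normr_id mulVf// gt_eqF.
Unshelve. all: by end_near. Qed.

(** A basis v of X modulo X', together with its coordinate map c.  The bound on
c is where the closedness of X' is needed. *)
Lemma codim_coords (X X' : set E) n :
  closed_subspace X -> closed_subspace X' -> codim X X' n ->
  exists (v : 'I_n -> E) (c : E -> 'rV[K]_n), [/\ forall i, X (v i),
    forall x, X x -> X' (x - \sum_(i < n) c x 0 i *: v i),
    forall x (a : 'rV[K]_n), X x ->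
      X' (x - \sum_(i < n) a 0 i *: v i) -> c x = a,
    forall k x y, X x -> X y -> c (k *: x + y) = k *: c x + c y &
    exists2 M : K, 0 < M & forall x, X x -> `|c x| <= M * `|x| ].
Proof.
move=> sX sX' [X'X [v Xv ex_coord]].
have /choice[c cP] : forall x, exists a : 'rV[K]_n,
    X x -> X' (x - \sum_(i < n) a 0 i *: v i).
  move=> x; have [Xx|nXx] := pselect (X x); last by exists 0.
  by have [a [Xa _]] := ex_coord x Xx; exists a.
have cU x (a : 'rV[K]_n) : X x -> X' (x - \sum_(i < n) a 0 i *: v i) -> c x = a.
  by move=> Xx Xa; have [b [_ bU]] := ex_coord x Xx;
    rewrite -(bU _ Xa) (bU (c x))//; exact: cP.
exists v, c; split => //.
  move=> k x y Xx Xy; apply: cU; first exact: subspace_lincomb.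
  rewrite lincombD opprD addrACA -scalerBr.
  by apply: subspace_lincomb => //; exact: cP.
have [a Xa|d d0 hd] := @span_away X' n v sX'.
  have X0 := subspace0 sX; have X'0 := subspace0 sX'.
  rewrite -(cU 0 a)//; last exact: subspaceB.
  by apply: cU => //; rewrite big1 ?subr0// => i _; rewrite mxE scale0r.
exists d^-1; first by rewrite invr_gt0.
move=> x Xx; rewrite mulrC ler_pdivlMr// mulrC.
by have := hd _ (c x) (cP _ Xx); rewrite subrK.
Qed.

End FiniteCodimension.

(** * The chain of projectors *)

Section ProjectorChain.
Context {R : realType} {K : numFieldType} {E : normedModType K}.
Hypothesis hK : real_or_complex R K.
Implicit Types (S T : bounded_operator E).

Lemma same_range_path S T :
  (forall x, S (T x) = T x) -> (forall x, T (S x) = S x) ->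
  path_connected_in R projectors S T.
Proof. by move=> ST TS; apply: segment_path => // s; exact: same_range_segment. Qed.

Lemma same_kernel_path S T :
  (forall x, S (T x) = S x) -> (forall x, T (S x) = T x) ->
  path_connected_in R projectors S T.
Proof. by move=> ST TS; apply: segment_path => // s; exact: same_kernel_segment. Qed.

(** The pair (a, b) gives the two coordinates of E, and j embeds the first
summand as the second one, so that a vector reads u + j v with u and v in the
range of a.  On that range N projects onto a subspace, h is an isomorphism onto
this subspace, and k is N followed by the inverse of h. *)
Variables a b j N h k : bounded_operator E.
Hypotheses (aa : forall x, a (a x) = a x) (ab : forall x, a (b x) = b x)
  (ba : forall x, b (a x) = 0) (aj : forall x, a (j x) = 0)
  (bj : forall x, b (j x) = a x) (aN : forall x, a (N x) = N x)
  (ah : forall x, a (h x) = h x) (ak : forall x, a (k x) = k x)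
  (Nh : forall x, N (h x) = h x) (kh : forall x, k (h x) = a x)
  (hk : forall x, h (k x) = N x).

Let fst_pair u v : a u = u -> a (u + j v) = u.
Proof. by move=> au; rewrite bopD au aj addr0. Qed.

Let snd_pair u v : a u = u -> a v = v -> b (u + j v) = v.
Proof. by move=> au av; rewrite bopD bj av -au ba add0r. Qed.

(** The projectors D, G, C below have the decompositions (A | Y), (A | Z) and
(X + F | Z) of the introduction.  In coordinates they are (x, x), (w, w) with
w = y - h (y - x), and (x - N y + k y, y - N y). *)
Lemma corner_shift_path :
  path_connected_in R projectors a
    (bop_add a (bop_comp j (bop_sub b (bop_comp N b)))).
Proof.
pose D := bop_add a (bop_comp j a).
pose w := bop_sub b (bop_comp h (bop_sub b a)).
pose G := bop_add w (bop_comp j w).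
pose c := bop_sub b (bop_comp N b).
pose C := bop_add (bop_add (bop_sub a (bop_comp N b)) (bop_comp k b))
  (bop_comp j c).
pose Q := bop_add a (bop_comp j c).
rewrite -/c -/Q.
have DE x : D x = a x + j (a x) by rewrite !(bop_addE, bop_subE, bop_compE).
have wE x : w x = b x - h (b x - a x) by rewrite !(bop_addE, bop_subE, bop_compE).
have GE x : G x = w x + j (w x) by rewrite !(bop_addE, bop_subE, bop_compE).
have cE x : c x = b x - N (b x) by rewrite !(bop_addE, bop_subE, bop_compE).
have CE x : C x = (a x - N (b x) + k (b x)) + j (c x).
  by rewrite !(bop_addE, bop_subE, bop_compE).
have QE x : Q x = a x + j (c x) by rewrite !(bop_addE, bop_subE, bop_compE).
have aw x : a (w x) = w x by rewrite wE bopB ab ah.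
have ac x : a (c x) = c x by rewrite cE bopB ab aN.
have NN x : N (N x) = N x by rewrite -(hk x) Nh.
have kN x : k (N x) = k x by rewrite -hk kh ak.
have Nc x : N (c x) = 0 by rewrite cE bopB NN subrr.
have kc x : k (c x) = 0 by rewrite cE bopB kN subrr.
have aC1 x : a (a x - N (b x) + k (b x)) = a x - N (b x) + k (b x).
  by rewrite bopD bopB aa aN ak.
have aD x : a (D x) = a x by rewrite DE fst_pair.
have bD x : b (D x) = a x by rewrite DE snd_pair.
have aG x : a (G x) = w x by rewrite GE fst_pair.
have bG x : b (G x) = w x by rewrite GE snd_pair.
have aC x : a (C x) = a x - N (b x) + k (b x) by rewrite CE fst_pair.
have bC x : b (C x) = c x by rewrite CE snd_pair.
have aQ x : a (Q x) = a x by rewrite QE fst_pair.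
have bQ x : b (Q x) = c x by rewrite QE snd_pair.
have cw x : w x - N (w x) = c x.
  by rewrite wE (bopB N) Nh opprB addrA subrK -cE.
have kw x : k (w x) = k (b x) - b x + a x.
  by rewrite wE (bopB k) kh (bopB a) ab aa opprB addrA addrAC.
(* From a to D the kernel is constant. *)
apply: (path_trans (B := D)).
  apply: same_kernel_path => x; first by rewrite aD.
  by rewrite !DE aa.
(* From D to G the range is the diagonal. *)
apply: (path_trans (B := G)).
  apply: same_range_path => x; first by rewrite DE aG -GE.
  rewrite GE; suff -> : w (D x) = a x by rewrite DE.
  by rewrite wE aD bD subrr bop0 subr0.
(* From G to C the kernel is Z. *)
apply: (path_trans (B := C)).
  apply: same_kernel_path => x.
    suff wC : w (C x) = w x by rewrite !GE wC.
    rewrite [LHS]wE aC bC.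
    have -> : c x - (a x - N (b x) + k (b x)) = b x - a x - k (b x).
      by rewrite cE opprD opprB addrA addrA subrK.
    by rewrite (bopB h) hk cE opprB addrA subrK wE.
  rewrite !CE aG bG.
  have -> : c (G x) = c x by rewrite cE bG cw.
  congr (_ + _); rewrite cw kw cE.
  by rewrite addrA [_ + (_ - _)]addrC subrKA addrC addrA addrAC.
(* From C to Q the range is constant. *)
apply: same_range_path => x.
  by rewrite CE aQ bQ Nc kc subr0 addr0 cE bQ Nc subr0 QE.
by rewrite QE aC cE bC Nc subr0 CE.
Qed.

End ProjectorChain.

(** * Operators built from maps between subspaces *)

Section OperatorsFromSubspaces.
Context {R : realType} {K : numFieldType} {E : normedModType K}.
Hypothesis hK : real_or_complex R K.
Implicit Types (X Y : set E) (S T : bounded_operator E).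

Lemma bop_of_bounded (f : E -> E) (M : K) :
  linear f -> 0 <= M -> (forall x, `|f x| <= M * `|x|) ->
  exists T : bounded_operator E, forall x, T x = f x.
Proof.
move=> lf M0 bf.
pose g : {linear E -> E} := HB.pack f (GRing.isLinear.Build K E E *:%R f lf).
have cg : continuous g.
  apply/linear_bounded_continuous/linear_boundedP.
  near=> r => x; apply: (le_trans (bf x)); rewrite ler_wpM2r//.
  by near: r; apply: nbhs_pinfty_ge; rewrite ger0_real.
by exists (BoundedOperator cg).
Unshelve. all: by end_near. Qed.

(** The inverse of a linear bijection between subspaces is linear, so both
directions of the isomorphism can be treated alike. *)
Lemma linearly_homeomorphicP X Y : closed_subspace X -> closed_subspace Y ->
  linearly_homeomorphic X Y ->
  exists f g : E -> E,
    [/\ forall x, X x -> Y (f x), forall y, Y y -> X (g y),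
        forall x, X x -> g (f x) = x & forall y, Y y -> f (g y) = y] /\
    [/\ forall k x y, X x -> X y -> f (k *: x + y) = k *: f x + f y,
        forall k x y, Y x -> Y y -> g (k *: x + y) = k *: g x + g y,
        {within X, continuous f} & {within Y, continuous g}].
Proof.
move=> sX sY [f [g [[fXY gYX fK gK] [fD fZ cf cg]]]].
have fK' x : X x -> g (f x) = x by move=> Xx; apply: fK; rewrite inE.
have gK' y : Y y -> f (g y) = y by move=> Yy; apply: gK; rewrite inE.
have flin k x y : X x -> X y -> f (k *: x + y) = k *: f x + f y.
  by move=> Xx Xy; rewrite fD ?fZ ?inE//; exact: subspaceZ.
exists f, g; split; split => // k x y Yx Yy.
rewrite -[RHS]fK'; last by apply: subspace_lincomb => //; exact: gYX.
by rewrite flin ?gK'//; exact: gYX.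
Qed.

(** A map that is linear and continuous on X only becomes a bounded operator on
E after any bounded operator with values in X. *)
Lemma bop_extend X (f : E -> E) T :
  (forall k x y, X x -> X y -> f (k *: x + y) = k *: f x + f y) ->
  {within X, continuous f} -> (forall x, X (T x)) ->
  exists S, forall x, S x = f (T x).
Proof.
move=> flin /subspace_continuousP cf XT.
have lin : linear (f \o T) by move=> k x y; rewrite /= bopD bopZ flin.
have cont : continuous (f \o T).
  move=> x W /(cf _ (XT x)) hW.
  have {}hW : nbhs (T x) (fun y => X y -> W (f y)) by exact: hW.
  have hTW := @bop_continuous _ _ T x _ hW.
  change (nbhs x (fun y => W (f (T y)))).
  by apply: (@filterS _ (nbhs x) _ _ _ _ hTW) => y; exact.
by exists (bop_of lin cont).
Qed.

Lemma lincomb_bound n (v : 'I_n -> E) :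
  exists2 M : K, 0 <= M &
    forall a : 'rV[K]_n, `|\sum_(i < n) a 0 i *: v i| <= M * `|a|.
Proof.
exists (\sum_(i < n) `|v i|); first exact: sumr_ge0.
move=> a; rewrite (le_trans (ler_norm_sum _ _ _))// mulr_suml ler_sum// => i _.
by rewrite normrZ mulrC ler_wpM2l// coord_le_mx_norm.
Qed.

(** The image of the unit ball lies in the image of a compact set of coefficient
vectors. *)
Lemma finite_rank_compact n (v : 'I_n -> E) (c : E -> 'rV[K]_n) (M : K)
    (T : E -> E) :
  (forall x, T x = \sum_(i < n) c x 0 i *: v i) ->
  (forall x, `|x| <= 1 -> `|c x| <= M) -> compact_operator T.
Proof.
move=> Tc cM; have [B cB hB] := scalar_ball_compact M hK.
have cC : compact ((fun a : 'rV[K]_n => \sum_(i < n) a 0 i *: v i) @`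
    [set a : 'rV[K]_n | forall i, B (a ord0 i)]).
  apply: continuous_compact; last exact: (rV_compact (fun=> cB)).
  by apply: continuous_subspaceT; exact: lincomb_continuous.
apply: precompact_subset (compact_precompact (@norm_hausdorff _ _) cC).
move=> _ [x x1 <-]; exists (c x) => // i.
by apply: hB; rewrite (le_trans (coord_le_mx_norm _ _))// cM.
Qed.

Lemma lincomb_delta n (v : 'I_n -> E) i :
  \sum_(l < n) (delta_mx 0 i : 'rV[K]_n) 0 l *: v l = v i.
Proof.
rewrite (bigD1 i)//= mxE !eqxx scale1r big1 ?addr0// => l /negPf li.
by rewrite mxE li andbF scale0r.
Qed.

(** Adding to the range of P the span of n independent vectors of its kernel
leaves P onto, and its kernel in the range of Q is that span. *)
Lemma finite_extension_index (P Q : bounded_operator E) n (u : 'I_n -> E)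
    (c : E -> 'rV[K]_n) :
  projectors P -> closed (range P) -> (forall i, P (u i) = 0) ->
  (forall x, Q x = P x + \sum_(i < n) c x 0 i *: u i) ->
  (forall a : 'rV[K]_n, c (\sum_(i < n) a 0 i *: u i) = a) ->
  projector_index Q P n%:Z.
Proof.
move=> pP clP Pu QE cu.
have Psum (a : 'rV[K]_n) : P (\sum_(i < n) a 0 i *: u i) = 0.
  by rewrite linear_sum big1// => i _; rewrite bopZ Pu scaler0.
have PQ x : P (Q x) = P x by rewrite QE bopD pP Psum addr0.
have imPQ : P @` range Q = range P.
  rewrite eqEsubset; split => [_ [_ [x _ <-] <-]|_ [x _ <-]]; first by exists (Q x).
  by exists (Q x) => //; exists x.
split; first by move=> x _; exists x.
  by rewrite imPQ.
exists n, 0%N; split; last by rewrite subr0.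
- split.
    move=> _ ->; split; last by rewrite /= bop0.
    by exists 0 => //; rewrite bop0.
  exists u.
    move=> i; split; last exact: Pu.
    exists (u i) => //; have ui := lincomb_delta u i.
    by rewrite QE Pu add0r -[in c _]ui cu ui.
  move=> _ [[x _ <-]]; rewrite /= PQ => Px0.
  have Qx : Q x = \sum_(i < n) c x 0 i *: u i by rewrite QE Px0 add0r.
  exists (c x); split => [|a].
    change (Q x - \sum_(i < n) c x 0 i *: u i = 0).
    by rewrite Qx subrr.
  change (Q x - \sum_(i < n) a 0 i *: u i = 0 -> c x = a).
  by rewrite Qx => /subr0_eq/(congr1 c); rewrite !cu.
- rewrite imPQ; split => //; exists (fun=> 0) => [i|x Px].
    by exists 0; rewrite ?bop0.
  exists 0; split; first by rewrite big_ord0 subr0.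
  by move=> a _; apply/rowP => -[].
Qed.

End OperatorsFromSubspaces.

(** * Construction of the projector *)

Theorem proposition4p6 (R : realType) (K : numFieldType)
  (hK : real_or_complex R K) (E : completeNormedModType K)
  (X Y : set E)
  (hX : closed_subspace X) (hY : closed_subspace Y)
  (hXY : linearly_homeomorphic X Y)
  (hsum : direct_sum_decomposition X Y)
  (m : nat) (hm : (0 < m)%N)
  (hcodim_ex : exists X' : set E, closed_subspace X' /\ codim X X' m)
  (hcodim : forall X' : set E, closed_subspace X' -> codim X X' m ->
     linearly_homeomorphic X X')
  (P : bounded_operator E) (hP : projectors P)
  (hPX : range P = X) (hPY : P @^-1` [set 0] = Y) :
  exists Q : bounded_operator E,
    [/\ projectors Q,
        path_connected_in R projectors P Q,
        compact_operator (fun x => Q x - P x) &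
        projector_index Q P m%:Z].
Proof.
have XP x : X (P x) by rewrite -hPX; exists x.
have PX x : X x -> P x = x by rewrite -hPX => -[y _ <-]; exact: hP.
have PY x : Y x -> P x = 0 by rewrite -hPY.
have YP x : P x = 0 -> Y x by rewrite -hPY.
have [f [g [[fXY gYX gf _] [flin glin cf cg]]]] :=
  linearly_homeomorphicP hX hY hXY.
have [X' [hX' codX']] := hcodim_ex.
have X'X : X' `<=` X by case: codX'.
have [h0 [k0 [[hXX' kX'X kh0 hk0] [hlin klin ch ck]]]] :=
  linearly_homeomorphicP hX hX' (hcodim X' hX' codX').
have [v [c [Xv cX' cU clin [M M0 cM]]]] := codim_coords hK hX hX' codX'.
(* The second coordinate b is f^-1 after the projector 1 - P onto Y; the
   isomorphism h0 and its inverse k0 are extended from X and X' to E. *)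
have [I IE] : exists I : bounded_operator E, forall x, I x = x.
  by apply: (@bop_of_bounded _ _ id 1) => //= x; rewrite mul1r.
have YIP x : Y (bop_sub I P x).
  by apply: YP; rewrite bop_subE IE bopB hP subrr.
have [j jE] := bop_extend flin cf XP.
have [b bE] := bop_extend glin cg YIP.
have [h hE] := bop_extend hlin ch XP.
have Xb x : X (b x) by rewrite bE; exact: gYX.
(* F projects X along X' onto the span of v. *)
have [F FE] : exists F : bounded_operator E,
    forall x, F x = \sum_(i < m) c (P x) 0 i *: v i.
  have [M1 M10 hM1] := lincomb_bound v; have [M2 M20 hM2] := bop_bound P.
  apply: (@bop_of_bounded _ _ _ (M1 * (M * M2))) => [||x].
    by move=> k x y; rewrite bopD bopZ clin// lincombD.
    by rewrite !mulr_ge0// ltW.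
  rewrite (le_trans (hM1 _))// -!mulrA ler_wpM2l//.
  by rewrite (le_trans (cM _ (XP x)))// ler_wpM2l// ltW.
pose N := bop_sub P F.
have NE x : N x = P x - \sum_(i < m) c (P x) 0 i *: v i by rewrite bop_subE FE.
have X'N x : X' (N x) by rewrite NE; exact: cX'.
have [k kE] := bop_extend klin ck X'N.
have NX' x : X' x -> N x = x.
  move=> X'x; have Xx := X'X _ X'x.
  have zero_comb : \sum_(i < m) (0 : 'rV[K]_m) 0 i *: v i = 0.
    by apply: big1 => i _; rewrite mxE scale0r.
  by rewrite NE PX// (cU x 0)// zero_comb subr0.
have X'h x : X' (h x) by rewrite hE; exact: hXX'.
have Xk x : X (k x) by rewrite kE; exact: kX'X.
have bj x : b (j x) = P x.
  have Yf : Y (f (P x)) by exact: fXY.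
  by rewrite bE bop_subE IE jE (PY _ Yf) subr0 gf.
have bX x : X x -> b x = 0.
  move=> Xx; rewrite bE bop_subE IE PX// subrr.
  have g0 := glin (-1) 0 0 (subspace0 hY) (subspace0 hY).
  by move: g0; rewrite scaler0 addr0 scaleN1r addNr.
have Pj x : P (j x) = 0 by rewrite jE; apply/PY/fXY.
pose Q := bop_add P (bop_comp j (bop_sub b (bop_comp N b))).
have pathPQ : path_connected_in R projectors P Q.
  apply: (@corner_shift_path _ _ _ hK P b j N h k) => //.
  - by move=> x; exact: PX.
  - by move=> x; exact: bX.
  - by move=> x; apply/PX/X'X.
  - by move=> x; apply/PX/X'X.
  - by move=> x; exact: PX.
  - by move=> x; exact: NX'.
  - by move=> x; rewrite kE NX'// hE kh0.
  - by move=> x; rewrite hE PX// kE hk0.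
(* Q is an end point of a path of projectors. *)
have projQ : projectors Q.
  by have [gam [_ D _ <-]] := pathPQ; apply: D; rewrite /= in_itv/= lexx ler01.
(* The correction to P is j F b, which factors through the rank-m projector F. *)
have QE x : Q x = P x + j (\sum_(i < m) c (b x) 0 i *: v i).
  by rewrite !(bop_addE, bop_subE, bop_compE) FE (PX _ (Xb x)) subKr.
have cs (a : 'rV[K]_m) : c (\sum_(i < m) a 0 i *: v i) = a.
  by apply: cU; [exact: subspace_sum|rewrite subrr; exact: subspace0].
have js (a : 'rV[K]_m) :
    \sum_(i < m) a 0 i *: j (v i) = j (\sum_(i < m) a 0 i *: v i).
  by rewrite linear_sum; apply: eq_bigr => i _; rewrite bopZ.
exists Q; split => //.
- have [M2 M20 hM2] := bop_bound b.
  apply: (@finite_rank_compact _ _ _ hK m (fun i => j (v i)) (fun x => c (b x))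
    (M * M2)).
    by move=> x; rewrite QE addrC addKr js.
  move=> x x1; rewrite (le_trans (cM _ (Xb x)))// ler_pM2l//.
  by rewrite (le_trans (hM2 x))// ler_piMr// ltW.
apply: (@finite_extension_index _ _ P Q m (fun i => j (v i))
  (fun x => c (b x))) => //.
- by rewrite hPX; case: hX.
- by move=> x; rewrite QE js.
- by move=> a; rewrite js bj PX ?cs//; exact: subspace_sum.
Qed.
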